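(* Let $k\ge2$ be fixed and let $H$ be an arbitrary $k$-uniform hypergraph with at least one edge. Then the threshold for the property ''$\mathcal H_k(n,p)$ contains an $H$-factor'' (with $n$ ranging over multiples of $v(H)$) satisfies $$th_H(n)=O\big(n^{-1/d^*(H)+o(1)}\big),$$ that is, there is a function $\varepsilon(n)\to0$ such that $\Pr(\mathcal H_k(n,p)\text{ has an }H\text{-factor})\to1$ whenever $p=\omega(n^{-1/d^*(H)+\varepsilon(n)})$.
   Context: $\mathcal H_k(n,p)$ is the random $k$-uniform hypergraph on $[n]$ with each $k$-subset an edge independently with probability $p$. An $H$-factor of an $n$-vertex hypergraph $G$ ($v(H)\mid n$) is a collection of $n/v(H)$ copies of $H$ in $G$ whose vertex sets partition $V(G)$. $th_H(n)$ denotes a threshold for this property. For a hypergraph $H'$ with at least two vertices, $d(H')=e(H')/(v(H')-1)$, and $d^*(H)=\max_{H'\subseteq H}d(H')$ over subhypergraphs with at least two vertices. *)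

(* Defs.v *)
From HB Require Import structures.
From mathcomp Require Import all_boot all_order all_algebra.
From mathcomp Require Import all_classical all_reals all_analysis.

Set Implicit Arguments.
Unset Strict Implicit.
Unset Printing Implicit Defensive.

Import Order.TTheory GRing.Theory Num.Theory.
Import numFieldNormedType.Exports.

Local Open Scope ring_scope.

(* A hypergraph whose vertex set is the whole finite type [T] is given by its
   set of edges, of type [{set {set T}}]. *)

Definition uniform (T : finType) (k : nat) (E : {set {set T}}) : bool :=
  [forall e in E, #|e| == k].

(* A hypergraph inside [T] with its own vertex set: (vertices, edges). *)
Definition subhyp_of (T : finType) (E : {set {set T}})
    (S : {set T} * {set {set T}}) : bool :=
  (S.2 \subset E) && [forall e in S.2, e \subset S.1].

Definition density (R : realType) (T : finType)
    (S : {set T} * {set {set T}}) : R :=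
  #|S.2|%:R / (#|S.1|%:R - 1).

(* The default value 0 is harmless: densities are nonnegative, and a hypergraph
   with at least two vertices is itself an index of the maximum. *)
Definition dstar (R : realType) (T : finType) (E : {set {set T}}) : R :=
  \big[Num.max/0]_(S : {set T} * {set {set T}}
                    | subhyp_of E S && (2 <= #|S.1|)%N) density R S.

Definition is_copy (V T : finType) (H : {set {set V}}) (G : {set {set T}})
    (C : {set T} * {set {set T}}) : bool :=
  subhyp_of G C &&
  [exists f : {ffun V -> T},
    [&& injectiveb f,
        C.1 == f @: [set: V]
      & C.2 == [set f @: e | e : {set V} in H]]].

Definition has_factor (V T : finType) (H : {set {set V}})
    (G : {set {set T}}) : bool :=
  [exists F : {set {set T} * {set {set T}}},
    [&& #|F| == (#|T| %/ #|V|)%N,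
        [forall C in F, is_copy H G C]
      & finset.partition [set C.1 | C in F] [set: T]]].

(* Probability that the random k-uniform hypergraph on 'I_n, in which every
   k-subset is an edge independently with probability p, satisfies P. *)
Definition prob_Hk (R : realType) (k n : nat) (p : R)
    (P : pred {set {set 'I_n}}) : R :=
  \sum_(G : {set {set 'I_n}} | uniform k G && P G)
    \prod_(e : {set 'I_n} | #|e| == k) (if e \in G then p else 1 - p).

(* n tends to infinity along the multiples of v *)
Definition multiples (v : nat) : set_system nat :=
  within (fun n => (v %| n)%N : Prop) \oo%classic.

#[export] Instance multiples_filter (v : nat) : Filter (multiples v).
Proof. exact: within_filter. Qed.

(* Main.v *)
(* For n = m * v(H), fix m disjoint copies of H and relabel them by a uniformly
   random permutation s.  An edge set U lies in the relabelled copies with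
   probability at most (e^2 v(H) / n) ^ c, where c is the number of vertices of U
   minus the number of its components: the position of one vertex of a component
   determines the copy of H into which the whole component goes.  Each component
   sits inside H, so #|U| <= d*(H) c, and the random H-factor is q-spread with
   q = (e^2 v(H) / n) ^ (1 / d*(H)); in particular every family of edge sets that
   covers all the H-factors has q-cost at least 1.

   A spread family is caught by a random set of density O(q log^2 n), by the
   minimal-fragment argument of Park and Pham.  Expose the random set in
   M = O(log n) rounds of density p / M.  After exposing W, replace the family F by
   the inclusion-minimal sets among the S :\: W.  Those of size at least t = 2^j
   have expected q-cost at most 4 q M / p, so all the others, of size below t, still
   have cover cost close to 1; each round thus halves the sizes.  Finally
   n ^ (1 / sqrt (ln n)) = exp (sqrt (ln n)) absorbs log^2 n. *)

Require Import Defs.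
From mathcomp Require Import all_boot all_order all_algebra.
From mathcomp Require Import all_classical all_reals all_analysis.
From mathcomp Require Import fintype finset fingroup perm.
From mathcomp Require Import ring lra.

Import Order.TTheory GRing.Theory Num.Theory.
Import numFieldNormedType.Exports.

Set Implicit Arguments.
Unset Strict Implicit.
Unset Printing Implicit Defensive.

Local Open Scope ring_scope.

(** * Random subsets and spread families *)

Definition bern (R : realFieldType) (X : finType) (p : X -> R) (W : {set X}) : R :=
  \prod_x (if x \in W then p x else 1 - p x).

Section Bernoulli.
Context (R : realFieldType) (X : finType).
Implicit Types (p : X -> R) (W : {set X}).

Lemma bern_ge0 p W : (forall x, 0 <= p x <= 1) -> 0 <= bern p W.
Proof.
move=> hp; apply: prodr_ge0 => x _; have /andP[p0 p1] := hp x.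
by case: ifP => // _; rewrite subr_ge0.
Qed.

Lemma sum_bern p : \sum_W bern p W = 1.
Proof.
rewrite /bern -(bigA_distr _ _ p (fun x => 1 - p x)) /=.
by apply: big1 => x _; rewrite addrC subrK.
Qed.

Lemma bern_setU_fiber p1 p2 W :
  \sum_W1 \sum_W2 (if W1 :|: W2 == W then bern p1 W1 * bern p2 W2 else 0) =
  bern (fun x => 1 - (1 - p1 x) * (1 - p2 x)) W.
Proof.
(* The indicator of [W1 :|: W2 = W] is a product over the points of X. *)
pose ind x (b1 b2 : bool) : R := if b1 || b2 == (x \in W) then 1 else 0.
pose f x b1 b2 : R := (if b1 then p1 x else 1 - p1 x) *
  (if b2 then p2 x else 1 - p2 x) * ind x b1 b2.
have indE W1 W2 : \prod_x ind x (x \in W1) (x \in W2) =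
    (if W1 :|: W2 == W then 1 else 0).
  case: eqP => [eqW|/eqP neqW].
    by apply: big1 => x _; rewrite /ind -eqW in_setU eqxx.
  have [x xP] : exists x, (x \in W1 :|: W2) != (x \in W).
    apply/existsP; apply: contraNT neqW; rewrite negb_exists => /forallP eqW.
    by apply/eqP/setP => x; apply/eqP; rewrite -[_ == _]negbK eqW.
  rewrite (bigD1 x) //= {1}/ind -in_setU (negPf xP) mul0r //.
transitivity (\sum_(W1 : {set X}) \sum_(W2 : {set X}) \prod_x f x (x \in W1) (x \in W2)).
  apply: eq_bigr => W1 _; apply: eq_bigr => W2 _.
  rewrite /f big_split big_split /= indE.
  by case: ifP; rewrite ?mulr1 ?mulr0.
transitivity (\sum_(W1 : {set X}) \prod_x (f x (x \in W1) true + f x (x \in W1) false)).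
  apply: eq_bigr => W1 _; rewrite bigA_distr; apply: eq_bigr => W2 _.
  by apply: eq_bigr => x _; case: (x \in W2).
transitivity (\prod_x ((f x true true + f x true false) +
                       (f x false true + f x false false))).
  rewrite bigA_distr; apply: eq_bigr => W1 _.
  by apply: eq_bigr => x _; case: (x \in W1).
apply: eq_bigr => x _; rewrite /f /ind /=; case: (x \in W) => /=; ring.
Qed.

(** Two-round exposure: the union of two independent random sets is again a random set with
    independent points, and it misses [x] exactly when both rounds do. *)
Lemma sum_bern_setU p1 p2 (f : {set X} -> R) :
  \sum_W1 bern p1 W1 * (\sum_W2 bern p2 W2 * f (W1 :|: W2)) =
  \sum_W bern (fun x => 1 - (1 - p1 x) * (1 - p2 x)) W * f W.
Proof.
under [RHS]eq_bigr => W _ do rewrite -(bern_setU_fiber p1 p2) mulr_suml.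
rewrite exchange_big; apply: eq_bigr => W1 _ /=.
under [RHS]eq_bigr => W _ do rewrite mulr_suml.
rewrite exchange_big mulr_sumr; apply: eq_bigr => W2 _ /=.
rewrite (bigD1 (W1 :|: W2)) //= eqxx big1 ?addr0 ?mulrA // => W neqW.
by rewrite eq_sym (negPf neqW) mul0r.
Qed.

(** Passing from [W] to [W :|: T] changes only the factors over [T], from [1 - p0] to [p0], and the
    former are at most 1. *)
Lemma bern_setU_le p (p0 : R) W (T : {set X}) :
  (forall x, 0 <= p x <= 1) -> 0 < p0 -> {in T, forall x, p x = p0} ->
  {in T, forall x, x \notin W} -> bern p W <= bern p (W :|: T) * p0 ^- #|T|.
Proof.
move=> hp p00 pT dWT; rewrite ler_pdivlMr ?exprn_gt0 //.
rewrite /bern (bigID (mem T)) [leRHS](bigID (mem T)) /= mulrAC.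
have -> : \prod_(x | x \notin T) (if x \in W :|: T then p x else 1 - p x) =
          \prod_(x | x \notin T) (if x \in W then p x else 1 - p x).
  by apply: eq_bigr => x xT; rewrite in_setU (negPf xT) orbF.
apply: ler_wpM2r.
  apply: prodr_ge0 => x _; have /andP[? ?] := hp x.
  by case: ifP => // _; rewrite subr_ge0.
rewrite -prodr_const -big_split; apply: ler_prod => x xT.
have /andP[p0x p1x] := hp x.
rewrite in_setU xT orbT -(pT x xT) (negPf (dWT x xT)) mulr_ge0 ?subr_ge0 //=.
by rewrite ler_piMl // lerBlDr lerDl.
Qed.

End Bernoulli.

(** * Minimal fragments and repeated exposure *)

Definition hits (X : finType) (F : {set {set X}}) (W : {set X}) : bool :=
  [exists S in F, S \subset W].

Definition miss (R : realFieldType) (X : finType) (p : X -> R)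
    (F : {set {set X}}) : R :=
  \sum_W bern p W * (~~ hits F W)%:R.

Definition fragments (X : finType) (F : {set {set X}}) (W : {set X}) :=
  [set T : {set X} | minset [pred A | A \in [set S :\: W | S in F]] T].

(* The value 0 outside D encodes a random subset of D as a random subset of X. *)
Definition prob_on (R : realFieldType) (X : finType) (D : {set X}) (a : R) (x : X) : R :=
  if x \in D then a else 0.

(** By the union bound, the cost of a cover bounds the chance that a [q]-random set contains a
    member of [F]. A lower bound on all costs passes to the fragments of [F], losing only the cost
    of the discarded ones. *)
Definition cover_cost_ge (R : realFieldType) (X : finType) (q : R)
    (F : {set {set X}}) (c : R) :=
  forall C : {set {set X}},
    (forall S, S \in F -> exists2 U, U \in C & U \subset S) ->
    c <= \sum_(U in C) q ^+ #|U|.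

Section Fragments.
Context (R : realFieldType) (X : finType).
Implicit Types (p : X -> R) (F : {set {set X}}) (W T S : {set X}).

Lemma hits_sub F W W' : W \subset W' -> hits F W -> hits F W'.
Proof.
move=> sW /exists_inP[S SF SW]; apply/exists_inP; exists S => //.
exact: subset_trans SW sW.
Qed.

(** If [S] in [F] lies in [W :|: T], then [S :\: W] lies in [T], so it equals [T] by minimality. *)
Lemma fragmentsP F W T : T \in fragments F W ->
  (exists2 S, S \in F & T = S :\: W) /\
  (forall S, S \in F -> S \subset W :|: T -> T \subset S).
Proof.
rewrite inE => /minsetP[/= /imsetP[S SF ->] minT]; split; first by exists S.
move=> S' S'F S'W.
have sub : S' :\: W \subset S :\: W.
  apply/subsetP => x; rewrite inE => /andP[xW /(subsetP S'W)].
  by rewrite inE (negPf xW).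
rewrite -(minT (S' :\: W) _ sub); first exact: subsetDl.
by apply/imsetP; exists S'.
Qed.

Lemma fragments_sub F W S : S \in F ->
  exists2 T, T \in fragments F W & T \subset S.
Proof.
move=> SF.
have [|T minT TS] := @minset_exists _ [pred A | A \in [set S :\: W | S in F]] (S :\: W).
  by apply/imsetP; exists S.
by exists T; rewrite ?inE //; exact: subset_trans TS (subsetDl _ _).
Qed.

Lemma fragment_cost p (p0 q : R) F t :
  (forall x, 0 <= p x <= 1) -> 0 <= q -> 0 < p0 -> 4 * q <= p0 -> (0 < t)%N ->
  {in F, forall S, {in S, forall x, p x = p0}} ->
  {in F, forall S, (#|S| <= 2 * t)%N} ->
  \sum_W bern p W * \sum_(T in fragments F W | (t <= #|T|)%N) q ^+ #|T| <=
  4 * q / p0.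
Proof.
move=> hp q0 p00 qp t0 pF cF.
(* A pair (W, T) is encoded by Z = W :|: T together with T as a subset of
   [pickS Z], a member of F inside Z that does not depend on T: by minimality
   every member of F inside Z contains T. *)
pose pickS W := odflt set0 [pick S in F | S \subset W].
have pickSP S W : S \in F -> S \subset W -> (pickS W \in F) && (pickS W \subset W).
  rewrite /pickS => SF SW; case: pickP => [S' /= //|/(_ S)].
  by rewrite SF SW.
have card_pickS W : (#|pickS W| <= 2 * t)%N.
  rewrite /pickS; case: pickP => [S /andP[SF _]|_] /=; first exact: cF.
  by rewrite cards0.
have bound T : \sum_(W | T \in fragments F W) bern p W <=
    p0 ^- #|T| * \sum_(Z | T \subset pickS Z) bern p Z.
  (* A fragment [T] is disjoint from [W], so [W] is recovered as [Z :\: T]. *)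
  rewrite (reindex_onto (fun Z => Z :\: T) (fun W => W :|: T)) /=; last first.
    move=> W /fragmentsP[[S SF ->] _].
    apply/setP => x; rewrite !inE.
    by case: (x \in W); case: (x \in S).
  rewrite mulr_sumr big_mkcond [leRHS]big_mkcond; apply: ler_sum => Z _.
  case: ifP => [/andP[Tfr /eqP ZT]|_]; last first.
    by case: ifP => // _; rewrite mulr_ge0 ?invr_ge0 ?exprn_ge0 ?bern_ge0 // ltW.
  move: ZT Tfr; set W := Z :\: T => ZT Tfr.
  have [[S SF TE] minT] := fragmentsP Tfr.
  have SZ : S \subset Z.
    apply/subsetP => x xS; rewrite -ZT in_setU TE in_setD xS andbT.
    by rewrite orbN.
  have /andP[pF' pZ] := pickSP _ _ SF SZ.
  rewrite minT ?ZT // mulrC -ZT; apply: bern_setU_le => //.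
    by move=> x; rewrite TE inE => /andP[_ xS]; exact: pF xS.
  by move=> x; rewrite TE inE => /andP[].
have qp1 : q / p0 <= 1 by rewrite ler_pdivrMr // mul1r; lra.
have qp00 : 0 <= q / p0 by rewrite divr_ge0 // ltW.
under eq_bigr do rewrite big_mkcondr mulr_sumr /=.
under eq_bigr do rewrite big_mkcond /=.
rewrite exchange_big /=.
apply: (@le_trans _ _ (\sum_(T : {set X}) \sum_Z
   (if (T \subset pickS Z) && (t <= #|T|)%N then (q / p0) ^+ t * bern p Z else 0))).
  apply: ler_sum => T _; case: leqP => tT; last first.
    by rewrite !big1 // => *; rewrite ?andbF ?mulr0 ?if_same.
  under [leRHS]eq_bigr do rewrite andbT.
  rewrite -!big_mkcond -mulr_suml -mulr_sumr /=.
  apply: le_trans (ler_wpM2r (exprn_ge0 _ q0) (bound T)) _.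
  rewrite mulrAC ler_wpM2r //; first by apply: sumr_ge0 => *; exact: bern_ge0.
  by rewrite mulrC -expr_div_n ler_wiXn2l // ?qp00.
rewrite exchange_big /=.
apply: (@le_trans _ _ (\sum_Z bern p Z * (4 * q / p0))); last first.
  by rewrite -mulr_suml sum_bern mul1r.
apply: ler_sum => Z _; rewrite -big_mkcond sumr_const -[leLHS]mulr_natl.
rewrite mulrA [leLHS]mulrC ler_wpM2l ?bern_ge0 //.
apply: (@le_trans _ _ ((4 * q / p0) ^+ t)); last first.
  by rewrite -[leRHS]expr1 ler_wiXn2l ?ler_pdivrMr ?mul1r // -mulrA mulr_ge0.
rewrite -mulrA [leRHS]exprMn ler_wpM2r ?exprn_ge0 //.
rewrite -natrX ler_nat (_ : 4 = 2 ^ 2)%N // -expnM.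
(* For fixed [Z], the sets [T] are subsets of [pickS Z], which has at most [2 * t] points: there are
   at most [4 ^ t] of them, each of weight at most [(q / p0) ^+ t]. *)
apply: (@leq_trans #|powerset (pickS Z)|).
  by apply/subset_leq_card/subsetP => T; rewrite !inE unfold_in /= => /andP[].
by rewrite card_powerset leq_exp2l.
Qed.

(** Induction on the number of rounds, for all [F] and [c] at once: the first round replaces [F] by
    its fragments of size below [2 ^ m], and [c] by [c] minus the cost of the larger ones, which
    averages to at most [4 * q / p0]. *)
Lemma miss_halving (D : {set X}) (p0 q : R) m F c :
  0 <= q -> 0 < p0 <= 1 -> 4 * q <= p0 ->
  {in F, forall S, S \subset D} -> {in F, forall S, (#|S| < 2 ^ m)%N} ->
  cover_cost_ge q F c ->
  miss (prob_on D (1 - (1 - p0) ^+ m)) F * c <= m%:R * (4 * q / p0).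
Proof.
move=> q0 /andP[p00 p01] qp.
have pm m' x : 0 <= prob_on D (1 - (1 - p0) ^+ m') x <= 1.
  rewrite /prob_on; case: ifP => _; last by rewrite lexx ler01.
  rewrite subr_ge0 lerBlDr lerDl exprn_ge0 ?subr_ge0 // andbT.
  by rewrite exprn_ile1 ?subr_ge0 // lerBlDr lerDl ltW.
elim: m F c => [|m IHm] F c FD cF costF.
  (* All members of [F] are empty here. Either [F] has no member and the empty cover forces
     [c <= 0], or [set0] is in [F] and every set hits [F]. *)
  rewrite mul0r.
  have [F0|[S SF]] := set_0Vmem F.
    apply: mulr_ge0_le0.
      by apply: sumr_ge0 => W _; rewrite mulr_ge0 ?bern_ge0 ?ler0n.
    have := costF set0; rewrite big_set0; apply => S.
    by rewrite F0 inE.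
  have S0 : S = set0.
    by apply/eqP; rewrite -cards_eq0; have := cF _ SF; rewrite expn0 ltnS leqn0.
  rewrite /miss big1 ?mul0r // => W _.
  suff -> : hits F W by rewrite mulr0.
  by apply/exists_inP; exists S => //; rewrite S0 sub0set.
have pE : prob_on D (1 - (1 - p0) ^+ m.+1) =1
    (fun x => 1 - (1 - prob_on D p0 x) * (1 - prob_on D (1 - (1 - p0) ^+ m) x)).
  by move=> x; rewrite /prob_on; case: ifP => _; rewrite ?exprS; ring.
have p0D x : 0 <= prob_on D p0 x <= 1.
  by rewrite /prob_on; case: ifP => _; rewrite ?lexx ?ler01 ?p01 ?ltW.
rewrite /miss (funext pE) -sum_bern_setU mulr_suml.
have cost := @fragment_cost (prob_on D p0) p0 q F (2 ^ m) p0D q0 p00 qp.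
rewrite expn_gt0 /= in cost; have {}cost := cost isT.
apply: (@le_trans _ _ (\sum_W bern (prob_on D p0) W * (m%:R * (4 * q / p0) +
   \sum_(T in fragments F W | (2 ^ m <= #|T|)%N) q ^+ #|T|))); last first.
  under eq_bigr do rewrite mulrDr.
  rewrite big_split /= -mulr_suml sum_bern mul1r
    -[m.+1]addn1 natrD [leRHS]mulrDl mul1r lerD2l.
  apply: cost => S SF.
    by move=> x /(subsetP (FD _ SF)); rewrite /prob_on => ->.
  by rewrite -expnS ltnW ?cF.
apply: ler_sum => W _; rewrite -mulrA ler_wpM2l ?bern_ge0 //.
set u := \sum_(T in _ | _) _.
have u0 : 0 <= u by apply: sumr_ge0 => T _; rewrite exprn_ge0.
pose F' := [set T in fragments F W | (#|T| < 2 ^ m)%N].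
set f := \sum_W2 _.
have f1 : f <= 1.
  rewrite -(sum_bern (prob_on D (1 - (1 - p0) ^+ m))); apply: ler_sum => W2 _.
  by rewrite ler_piMr ?bern_ge0 // lern1 leq_b1.
have f0 : 0 <= f.
  by apply: sumr_ge0 => W2 _; rewrite mulr_ge0 ?bern_ge0 ?ler0n.
(* If [W2] contains a fragment [S :\: W], then [W :|: W2] contains [S]. *)
have fF' : f <= miss (prob_on D (1 - (1 - p0) ^+ m)) F'.
  apply: ler_sum => W2 _; rewrite ler_wpM2l ?bern_ge0 // ler_nat.
  have [/exists_inP[T]|_] := boolP (hits F' W2); last by case: hits.
  rewrite inE => /andP[/fragmentsP[[S SF ->] _] _] SW2.
  suff -> : hits F (W :|: W2) by [].
  by apply/exists_inP; exists S => //; rewrite -subDset.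
have IH : miss (prob_on D (1 - (1 - p0) ^+ m)) F' * (c - u) <= m%:R * (4 * q / p0).
  apply: IHm => [T|T|C coverC].
  - rewrite inE => /andP[/fragmentsP[[S SF ->] _] _].
    exact: subset_trans (subsetDl _ _) (FD _ SF).
  - by rewrite inE => /andP[].
  - rewrite lerBlDr.
    (* The large fragments complete any cover of the small ones to a cover of [F]. *)
    pose B := [set T in fragments F W | (2 ^ m <= #|T|)%N].
    apply: le_trans (_ : \sum_(U in C :|: B) q ^+ #|U| <= _).
      apply: costF => S SF; have [T Tfr TS] := fragments_sub W SF.
      have [tT|tT] := leqP (2 ^ m) #|T|.
        by exists T; rewrite // inE; apply/orP; right; rewrite inE Tfr.
      have [|U UC UT] := coverC T; first by rewrite inE Tfr tT.
      by exists U; [rewrite inE UC | exact: subset_trans UT TS].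
    have -> : u = \sum_(U in B) q ^+ #|U| by apply: eq_bigl => T; rewrite [RHS]inE.
    rewrite [leLHS]big_mkcond [X in X + _]big_mkcond [X in _ + X]big_mkcond /=.
    rewrite -big_split /=; apply: ler_sum => U _; rewrite inE.
    have qU : 0 <= q ^+ #|U| by rewrite exprn_ge0.
    by case: (U \in C); case: (U \in B); rewrite /= ?addr0 ?add0r ?lerDl.
(* Split [c] as [(c - u) + u]: induction bounds the first part, [f <= 1] the second. If [c < u],
   then [f * c <= f * u <= u] is enough. *)
have [cu|/ltW cu] := lerP 0 (c - u).
  have := le_trans (ler_wpM2r cu fF') IH.
  rewrite mulrBr lerBlDr => /le_trans; apply.
  by rewrite lerD2l ler_piMl.
rewrite subr_le0 in cu.
apply: (@le_trans _ _ (f * u)); first by rewrite ler_wpM2l.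
rewrite (@le_trans _ _ u) ?ler_piMl // lerDr mulr_ge0 //.
by rewrite mulr_ge0 ?invr_ge0 ?mulr_ge0 // ltW.
Qed.

(** Coupling: density [b] is density [a] followed by an independent round of density
    [d = (b - a) / (1 - a)], and extra points can only help to hit [F]. *)
Lemma miss_antimono D (a b : R) F : 0 <= a -> a <= b -> b <= 1 ->
  miss (prob_on D b) F <= miss (prob_on D a) F.
Proof.
move=> a0 ab b1.
have [a1|a1] := eqVneq a 1.
  by have -> : b = a by apply/eqP; rewrite eq_le ab a1 b1.
have {}a1 : 0 < 1 - a by rewrite subr_gt0 lt_neqAle a1 (le_trans ab).
pose d := (b - a) / (1 - a).
have d01 : 0 <= d <= 1.
  by rewrite /d divr_ge0 ?subr_ge0 ?(le_trans ab) //= ler_pdivrMr // mul1r lerD2r.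
have pE : prob_on D b =1 (fun x => 1 - (1 - prob_on D a x) * (1 - prob_on D d x)).
  move=> x; rewrite /prob_on; case: ifP => _; last by ring.
  by rewrite /d; field; rewrite gt_eqF.
rewrite /miss (funext pE) -sum_bern_setU.
apply: ler_sum => W _; apply: ler_wpM2l.
  by apply: bern_ge0 => x; rewrite /prob_on; case: ifP;
    rewrite ?lexx ?ler01 ?a0 ?(le_trans ab).
have pd x : 0 <= prob_on D d x <= 1 by rewrite /prob_on; case: ifP; rewrite ?lexx ?ler01.
rewrite -[leRHS]mul1r -[X in _ <= X * _](sum_bern (prob_on D d)) mulr_suml.
apply: ler_sum => W2 _; rewrite ler_wpM2l ?bern_ge0 // ler_nat.
by case: (boolP (hits F W)) => [/(hits_sub (subsetUl W W2)) -> //|_]; case: hits.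
Qed.

(** Run [m] rounds of density [p / m]: by Bernoulli's inequality their union has density at most
    [p], so [miss_antimono] transfers the bound of [miss_halving]. *)
Lemma miss_spread (D : {set X}) (p q : R) m F :
  0 <= q -> 0 < p <= 1 -> (0 < m)%N -> 4 * m%:R * q <= p ->
  {in F, forall S, S \subset D} -> {in F, forall S, (#|S| < 2 ^ m)%N} ->
  cover_cost_ge q F 1 ->
  miss (prob_on D p) F <= 4 * m%:R ^+ 2 * q / p.
Proof.
move=> q0 /andP[p0 p1] m0 qp FD cF cost.
have mR : 0 < m%:R :> R by rewrite ltr0n.
have m1 : 1 <= m%:R :> R by rewrite ler1n.
have pm0 : 0 < p / m%:R by rewrite divr_gt0.
have pm1 : p / m%:R <= 1 by rewrite ler_pdivrMr // mul1r (le_trans p1).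
have := @miss_halving D (p / m%:R) q m F 1 q0.
rewrite pm0 pm1 mulr1 ler_pdivlMr // => /(_ isT).
have -> : 4 * q * m%:R = 4 * m%:R * q by ring.
move=> /(_ qp FD cF cost).
have -> : m%:R * (4 * q / (p / m%:R)) = 4 * m%:R ^+ 2 * q / p.
  by field; rewrite !gt_eqF.
apply: le_trans; apply: miss_antimono => //.
  by rewrite subr_ge0 exprn_ile1 ?subr_ge0 // lerBlDr lerDl ltW.
rewrite lerBlDr -lerBlDl.
have bernoulli k (x : R) : 0 <= x <= 1 -> 1 - k%:R * x <= (1 - x) ^+ k.
  move=> /andP[x0 x1]; elim: k => [|k IH]; first by rewrite mul0r subr0 expr0.
  have kx : 0 <= k%:R * (x * x) :> R by rewrite !mulr_ge0.
  rewrite exprS; apply: le_trans (ler_wpM2l _ IH); last by rewrite subr_ge0.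
  rewrite -addn1 natrD; nra.
have := bernoulli m (p / m%:R); rewrite pm1 (ltW pm0) => /(_ isT).
by rewrite mulrCA divff ?gt_eqF // mulr1.
Qed.

End Fragments.

(** * Random relabellings of disjoint copies *)

Lemma card_fiber_le (A B : finType) (D : {set A}) (f : A -> B) (k : nat) :
  (forall b, #|[set x in D | f x == b]| <= k)%N -> (#|D| <= #|B| * k)%N.
Proof.
move=> fk; rewrite -sum1_card (partition_big f predT) //= -sum_nat_const.
apply: leq_sum => b _; apply: leq_trans (fk b).
by rewrite -sum1_card; apply/eq_leq/eq_bigl => x; rewrite inE.
Qed.

(** The map sending [s] to [s^-1 * s0] embeds these permutations into those that move only points
    outside [X]. *)
Lemma card_perm_agree (T : finType) (X : {set T}) (s0 : {perm T}) :
  (#|[set s : {perm T} | [forall x in X, s^-1%g x == s0^-1%g x]]|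
     <= (#|T| - #|X|)`!)%N.
Proof.
have inj : injective (fun s : {perm T} => s^-1 * s0)%g.
  by move=> s t /mulIg /invg_inj.
rewrite -(cardsC X) addKn -card_perm -(card_imset _ inj).
apply/subset_leq_card/subsetP => _ /imsetP[s + ->]; rewrite inE => /forall_inP sX.
apply/subsetP => x; rewrite !inE; apply: contraNN => xX.
by rewrite permM (eqP (sX x xX)) permKV.
Qed.

Section Template.
Context (T V I : finType) (h : I * V -> T) (g : T -> I * V).
Context (hK : cancel h g) (gK : cancel g h).
Context (H : {set {set V}}).

(** [h] lays out disjoint copies of [H], indexed by [I], whose vertex sets tile [T]; [s] relabels
    them. *)
Definition copyfun (s : {perm T}) (i : I) (v : V) : T := s (h (i, v)).

Definition factor_edges (s : {perm T}) : {set {set T}} :=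
  [set copyfun s ie.1 @: ie.2 | ie : I * {set V} in setX [set: I] H].

Lemma copyfun_inj s i : injective (copyfun s i).
Proof. by move=> v w /perm_inj /(can_inj hK) []. Qed.

Lemma card_factor_edges s : (#|factor_edges s| <= #|I| * #|H|)%N.
Proof. by apply: leq_trans (leq_imset_card _ _) _; rewrite cardsX cardsT. Qed.

Lemma factor_edgesP s A :
  reflect (exists i e, e \in H /\ A = copyfun s i @: e) (A \in factor_edges s).
Proof.
apply: (iffP imsetP) => [[[i e]]|[i [e [eH ->]]]].
  by rewrite !inE /= => eH ->; exists i, e.
by exists (i, e); rewrite // !inE.
Qed.

Lemma has_factor_edges s (G : {set {set T}}) :
  (0 < #|V|)%N -> factor_edges s \subset G -> has_factor H G.
Proof.
move=> V0 sG.
have TE : (#|T| = #|I| * #|V|)%N.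
  by rewrite -card_prod; exact: bij_eq_card (Bijective gK hK).
pose C i := (copyfun s i @: [set: V], [set copyfun s i @: e | e : {set V} in H]).
have Cdisj i j x : x \in (C i).1 -> x \in (C j).1 -> i = j.
  by move=> /imsetP[v _ ->] /imsetP[w _ /perm_inj/(can_inj hK)[]].
(* Nonempty vertex sets make the copies distinct, so that there are exactly [#|I|] of them, and
   exclude an empty block. *)
have Cne i : exists x, x \in (C i).1.
  have [v _] := card_gt0P V0.
  by exists (copyfun s i v); rewrite imset_f.
have Cinj : injective (fun i => (C i).1).
  by move=> i j ij; have [x xi] := Cne i; apply: (Cdisj i j x) => //; rewrite -ij.
apply/existsP; exists [set C i | i : I]; apply/and3P; split.
- rewrite card_imset ?cardsT ?TE ?mulnK // => i j ij; apply: Cinj.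
  by rewrite ij.
- apply/forall_inP => _ /imsetP[i _ ->].
  rewrite /is_copy; apply/andP; split.
    apply/andP; split.
      apply/subsetP => _ /imsetP[e eH ->]; apply: (subsetP sG).
      by apply/factor_edgesP; exists i, e.
    apply/forall_inP => _ /imsetP[e eH ->].
    by apply/imsetS; rewrite subsetT.
  apply/existsP; exists [ffun v => copyfun s i v].
  have fE : [ffun v => copyfun s i v] =1 copyfun s i by move=> v; rewrite ffunE.
  apply/and3P; split.
  + by apply/injectiveP => v w; rewrite !ffunE => /copyfun_inj.
  + by rewrite (eq_imset _ fE).
  + by apply/eqP/eq_imset => e; rewrite (eq_imset _ fE).
- apply/and3P; split.
  + rewrite eqEsubset subsetT; apply/subsetP => x _.
    apply/bigcupP; exists (C (g (s^-1%g x)).1).1.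
      by apply/imsetP; exists (C (g (s^-1%g x)).1) => //; rewrite imset_f.
    apply/imsetP; exists (g (s^-1%g x)).2 => //.
    by rewrite /copyfun -surjective_pairing gK permKV.
  + apply/trivIsetP => _ _ /imsetP[_ /imsetP[i _ ->] ->] /imsetP[_ /imsetP[j _ ->] ->] ij.
    rewrite -setI_eq0; apply/eqP/setP => x; rewrite !inE.
    apply/negP => /andP[xi xj]; move: ij; rewrite (Cdisj _ _ _ xi xj).
    by rewrite eqxx.
  + apply/negP => /imsetP[_ /imsetP[i _ ->] /setP C0].
    by have [x] := Cne i; rewrite -C0 inE.
Qed.

(** * Counting the relabellings that contain a given edge set *)

Section Count.
Context (U : {set {set T}}).

Definition adj : rel T := fun x y => [exists A in U, (x \in A) && (y \in A)].
Definition comp_root : T -> T := fingraph.root adj.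
(* Vertices outside [cover U] are their own roots, so [nonroots] has (number of
   vertices of U) - (number of components of U) elements, and [roots] lists the
   representatives of the components with at least two vertices only. *)
Definition nonroots : {set T} := [set x | comp_root x != x].
Definition roots : {set T} := comp_root @: nonroots.
Definition perms_containing : {set {perm T}} := [set s | U \subset factor_edges s].
(* The copy of H and the vertex of H that occupy x. *)
Definition pos (s : {perm T}) (x : T) : I * V := g (s^-1%g x).

Lemma pos_inj s : injective (pos s).
Proof. by move=> x y /(can_inj gK) /perm_inj. Qed.

Lemma pos_copyfun s i v : pos s (copyfun s i v) = (i, v).
Proof. by rewrite /pos /copyfun permK hK. Qed.

Lemma adj_sym : connect_sym adj.
Proof.
apply: fingraph.sym_connect_sym => x y; apply: eq_existsb => A.
by congr (_ && _); rewrite andbC.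
Qed.

Lemma comp_rootK x : comp_root (comp_root x) = comp_root x.
Proof. exact: fingraph.root_root adj_sym x. Qed.

Lemma adj_comp_root x y : adj x y -> comp_root x = comp_root y.
Proof. by move=> xy; apply/(fingraph.rootP adj_sym)/connect1. Qed.

(** Each edge of [U] lies in a single copy, so the copy index is constant along a path from [x] to
    its root. *)
Lemma pos_block s x : s \in perms_containing -> (pos s (comp_root x)).1 = (pos s x).1.
Proof.
rewrite inE => /subsetP Us; apply/esym.
have /connectP[p] := connect_root adj x; rewrite -/(comp_root x).
elim: p x (comp_root x) => [|y p IHp] x z /=; first by move=> _ ->.
move=> /andP[/exists_inP[A AU /andP[xA yA]] pth] zE.
rewrite -(IHp y z pth zE).
move: xA yA; have /factor_edgesP[i [e [_ ->]]] := Us A AU.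
by move=> /imsetP[v _ ->] /imsetP[w _ ->]; rewrite !pos_copyfun.
Qed.

Lemma card_roots : (#|roots| <= #|nonroots|)%N.
Proof. exact: leq_imset_card. Qed.

Lemma roots_nonroots_disj : nonroots :&: roots = set0.
Proof.
apply/setP => x; rewrite !inE; apply/negP => /andP[xN /imsetP[y _ xE]].
by move: xN; rewrite xE comp_rootK eqxx.
Qed.

(** A root may sit anywhere in [I * V], which has [#|T|] elements. A nonroot lies in the copy of its
    root, so only its vertex of [H] is free. The remaining points are permuted arbitrarily. *)
Lemma card_perms_containing :
  (#|perms_containing| <= #|T| ^ #|roots| * #|V| ^ #|nonroots| *
     (#|T| - (#|roots| + #|nonroots|))`!)%N.
Proof.
pose code s := ([ffun x : {x | x \in roots} => pos s (val x)],
                [ffun x : {x | x \in nonroots} => (pos s (val x)).2]).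
have cT : #|T| = #|{: I * V}| by exact: bij_eq_card (Bijective gK hK).
have := @card_fiber_le _ _ perms_containing code (#|T| - (#|roots| + #|nonroots|))`!.
rewrite card_prod !card_ffun !card_sig -cT; apply => b.
have [->|[s0]] := set_0Vmem [set s in perms_containing | code s == b].
  by rewrite cards0.
rewrite inE => /andP[s0v /eqP s0b].
have := card_perm_agree (nonroots :|: roots) s0.
rewrite cardsU roots_nonroots_disj cards0 subn0 addnC; apply: leq_trans.
apply/subset_leq_card/subsetP => s; rewrite !inE => /andP[sv /eqP sb].
have rE x : x \in roots -> pos s x = pos s0 x.
  move=> xr; have /ffunP/(_ (exist _ x xr)) : (code s).1 = (code s0).1.
    by rewrite sb s0b.
  by rewrite !ffunE.
suff E x : x \in nonroots :|: roots -> pos s x = pos s0 x.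
  by apply/forall_inP => x /E /(can_inj gK) ->.
rewrite in_setU => /orP[xN|]; last exact: rE.
rewrite [LHS]surjective_pairing [RHS]surjective_pairing; congr (_, _).
  rewrite -[LHS]pos_block ?inE // -[RHS]pos_block // rE //.
  by rewrite imset_f.
have /ffunP/(_ (exist _ x xN)) : (code s).2 = (code s0).2 by rewrite sb s0b.
by rewrite !ffunE.
Qed.

(** Under [s], each component of [U] falls into one copy, and [lam] projects it injectively onto a
    subhypergraph of [H], whose density is at most [dstar R H]. Summing over the components gives
    the bound. *)
Lemma card_le_dstar (R : realType) (k : nat) (s : {perm T}) :
  (2 <= k)%N -> uniform k H -> s \in perms_containing ->
  #|U|%:R <= dstar R H * #|nonroots|%:R.
Proof.
move=> k2 Hk sv; have Us := sv; rewrite inE in Us; move/subsetP in Us.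
pose comp r := [set x | comp_root x == r].
pose edges r := [set A in U | A \subset comp r].
pose lam x := (pos s x).2.
have lam_inj r : {in comp r &, injective lam}.
  move=> x y; rewrite !inE => /eqP xr /eqP yr xy; apply: (@pos_inj s).
  rewrite [LHS]surjective_pairing [RHS]surjective_pairing; congr (_, _) => //.
  by rewrite -pos_block // xr -yr pos_block.
(* Besides its nonroots a component has exactly one vertex, its root; this matches the [- 1] in
   [density]. *)
have ccomp r : r \in roots -> #|comp r| = #|[set x in nonroots | comp_root x == r]|.+1.
  move=> /imsetP[y _ rE]; rewrite (cardsD1 r) inE {1}rE comp_rootK -rE eqxx add1n.
  congr _.+1; apply: eq_card => x; rewrite !inE.
  by have [xr|] := eqVneq (comp_root x) r; rewrite ?andbF ?andbT ?xr 1?eq_sym.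
have dens r : r \in roots ->
    #|edges r|%:R <= dstar R H * #|[set x in nonroots | comp_root x == r]|%:R.
  move=> rr; pose S := (lam @: comp r, [set lam @: A | A : {set T} in edges r]).
  have cS1 : #|S.1| = #|comp r| by apply: card_in_imset; exact: lam_inj.
  have cS2 : #|S.2| = #|edges r|.
    apply: card_in_imset => A B; rewrite !inE => /andP[_ Ar] /andP[_ Br] AB.
    apply/setP => x; apply/idP/idP => xA.
      have : lam x \in lam @: B by rewrite -AB imset_f.
      move=> /imsetP[y yB lxy].
      by rewrite (lam_inj r x y (subsetP Ar x xA) (subsetP Br y yB) lxy).
    have : lam x \in lam @: A by rewrite AB imset_f.
    move=> /imsetP[y yA lxy].
    by rewrite (lam_inj r x y (subsetP Br x xA) (subsetP Ar y yA) lxy).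
  have nr0 : (0 < #|[set x in nonroots | comp_root x == r]|)%N.
    have /imsetP[y yN rE] := rr.
    by apply/card_gt0P; exists y; rewrite inE yN rE eqxx.
  have Ssub : subhyp_of H S && (2 <= #|S.1|)%N.
    rewrite cS1 ccomp // ltnS nr0 andbT; apply/andP; split.
      apply/subsetP => _ /imsetP[A + ->]; rewrite inE => /andP[/Us AU _].
      have /factor_edgesP[i [e [eH ->]]] := AU.
      rewrite -imset_comp (@eq_imset _ _ _ id) ?imset_id // => v /=.
      by rewrite /lam pos_copyfun.
    apply/forall_inP => _ /imsetP[A + ->]; rewrite inE => /andP[_ Ar].
    exact: imsetS.
  have : density R S <= dstar R H by exact: (le_bigmax_cond 0 (@density R V) Ssub).
  rewrite /density cS1 cS2 ccomp // -addn1 natrD addrK.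
  by rewrite ler_pdivrMr ?ltr0n.
apply: (@le_trans _ _ (\sum_(r in roots) #|edges r|%:R)); last first.
  apply: le_trans (ler_sum _ dens) _; rewrite -mulr_sumr -natr_sum.
  rewrite ler_wpM2l //; first exact: bigmax_ge_id.
  rewrite ler_nat -[leqRHS]sum1_card
    [leqRHS](partition_big comp_root (fun r => r \in roots)) /=; last first.
    by move=> x xN; rewrite imset_f.
  apply: leq_sum => r _; rewrite -sum1_card; apply/eq_leq/eq_bigl => x.
  by rewrite inE.
(* Every edge of [U] is counted: having [k >= 2] vertices, it lies in a component with a nonroot,
   whose root is thus in [roots]. *)
rewrite -natr_sum ler_nat -sum1_card.
under [leqRHS]eq_bigr do rewrite -sum1_card.
under [leqRHS]eq_bigr do under eq_bigl do rewrite inE.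
under [leqRHS]eq_bigr do rewrite big_mkcondr /=.
rewrite exchange_big /=; apply: leq_sum => A AU.
have /factor_edgesP[i [e [eH AE]]] := Us A AU.
have cA : #|A| = k.
  rewrite AE card_imset; last exact: copyfun_inj.
  by have /forall_inP/(_ e eH)/eqP := Hk.
have [x [y [xA yA xy]]] : exists x y, [/\ x \in A, y \in A & x != y].
  by have /card_gt1P[x [y [? ? ?]]] : (1 < #|A|)%N; [rewrite cA|exists x, y].
have Aroot z : z \in A -> comp_root z = comp_root x.
  move=> zA; apply: adj_comp_root; apply/exists_inP; exists A => //.
  by rewrite zA.
have rr : comp_root x \in roots.
  have [xN|] := boolP (x \in nonroots); first by rewrite imset_f.
  rewrite inE negbK => /eqP xr.
  suff yN : y \in nonroots by rewrite -(Aroot y yA) imset_f.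
  by rewrite inE (Aroot y yA) xr.
rewrite (bigD1 (comp_root x)) //= (_ : A \subset _) //.
by apply/subsetP => z zA; rewrite inE (Aroot z zA).
Qed.

End Count.
End Template.

(** * The random hypergraph *)

(** Induction on [n], using [(1 + 1/n) ^ j <= e ^ (j/n) <= e] for [j <= n]. *)
Lemma exp_fact_le (R : realType) (n j : nat) : (j <= n)%N ->
  n%:R ^+ j * (n - j)`!%:R <= expR 1 ^+ j * n`!%:R :> R.
Proof.
have e1 : 1 <= expR 1 :> R by rewrite (le_trans _ (expR_ge1Dx _)) // lerDl.
elim: n j => [|n IHn] [|j]; rewrite ?expr0 ?subn0 // ltnS => jn.
have step : n.+1%:R ^+ j <= expR 1 * n%:R ^+ j :> R.
  have [n0|n0] := posnP n.
    by move: jn; rewrite n0 leqn0 => /eqP ->; rewrite !expr0 mulr1.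
  have nR : 0 < n%:R :> R by rewrite ltr0n.
  have -> : n.+1%:R = (1 + n%:R^-1) * n%:R :> R.
    by rewrite mulrDl mulVf ?gt_eqF // mul1r -addn1 natrD addrC.
  rewrite exprMn ler_wpM2r ?exprn_ge0 //.
  have nV : 0 <= n%:R^-1 :> R by rewrite invr_ge0.
  apply: (@le_trans _ _ (expR n%:R^-1 ^+ j)).
    by rewrite lerXn2r ?nnegrE ?expR_ge0 ?addr_ge0 // expR_ge1Dx.
  rewrite -expRM_natl ler_expR ler_pdivrMr // mul1r ler_nat //.
rewrite subSS !exprS factS natrM.
rewrite mulrAC.
apply: le_trans (ler_wpM2l _ step) _; first by rewrite mulr_ge0.
rewrite [leRHS]mulrACA [leLHS]mulrACA [_ * n%:R ^+ j]mulrC [expR 1 * _]mulrC.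
by rewrite ler_wpM2l ?mulr_ge0 ?expR_ge0 // IHn.
Qed.

Lemma card_eq_bij (A B : finType) : #|A| = #|B| ->
  exists (h : A -> B) (g : B -> A), cancel h g /\ cancel g h.
Proof.
move=> AB.
exists (fun x => enum_val (cast_ord AB (enum_rank x))),
  (fun y => enum_val (cast_ord (esym AB) (enum_rank y))).
by split=> x; rewrite enum_valK ?cast_ordK ?cast_ordKV enum_rankK.
Qed.

(** * Spreadness of the random factor *)

Section Spread.
Context (R : realType) (k : nat) (T V I : finType) (h : I * V -> T) (g : T -> I * V).
Context (hK : cancel h g) (gK : cancel g h).
Context (H : {set {set V}}) (k2 : (2 <= k)%N) (Hk : uniform k H).
Local Notation n := #|T|.
Local Notation base := (expR 1 ^+ 2 * #|V|%:R / n%:R : R).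

(** With [a] roots and [b] nonroots, [exp_fact_le] costs a factor [e ^ (a + b)]. Since [a <= b] this
    is at most [e ^ (2 * b)], whence the square in [base]. *)
Lemma card_perms_containing_le (U : {set {set T}}) : (0 < n)%N ->
  #|perms_containing h H U|%:R <= n`!%:R * base ^+ #|nonroots U| :> R.
Proof.
move=> n0; have nR : 0 < n%:R :> R by rewrite ltr0n.
set b := #|nonroots U|; set a := #|roots U|.
have ab : (a <= b)%N := card_roots U.
have abn : (a + b <= n)%N.
  have := max_card (mem (nonroots U :|: roots U)).
  by rewrite cardsU roots_nonroots_disj cards0 subn0 addnC.
have e1 : 1 <= expR 1 :> R by rewrite (le_trans _ (expR_ge1Dx _)) // lerDl.
have := card_perms_containing hK gK H U; rewrite -/a -/b => cv.
have {}cv : #|perms_containing h H U|%:R <=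
    n%:R ^+ a * #|V|%:R ^+ b * (n - (a + b))`!%:R :> R.
  by rewrite -!natrX -!natrM ler_nat.
have F := exp_fact_le R abn.
have baseE : base ^+ b * n%:R ^+ b = expR 1 ^+ (2 * b) * #|V|%:R ^+ b.
  by rewrite -exprMn divfK ?gt_eqF // exprMn -exprM.
rewrite -(ler_pM2r (_ : 0 < n%:R ^+ b :> R)) ?exprn_gt0 // -[leRHS]mulrA baseE.
rewrite -(ler_pM2r (_ : 0 < n%:R ^+ a :> R)) ?exprn_gt0 // -[leLHS]mulrA -exprD.
rewrite [(b + a)%N]addnC.
apply: le_trans (ler_wpM2r _ cv) _; first by rewrite exprn_ge0.
rewrite -[leLHS]mulrA [(n - _)`!%:R * _]mulrC.
apply: le_trans (ler_wpM2l _ F) _; first by rewrite mulr_ge0 ?exprn_ge0.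
have mulrACB (x y z w : R) : x * (y * z) * w = w * z * (y * x) by ring.
rewrite mulrACB ler_wpM2l ?mulr_ge0 ?exprn_ge0 // ler_wpM2r // ler_weXn2l //.
by rewrite mul2n -addnn leq_add2r.
Qed.

(** As [base <= 1], lowering the exponent from [#|nonroots U|] to [#|U| / dstar R H] only enlarges
    the power. *)
Lemma perms_containing_spread (U : {set {set T}}) : (0 < n)%N -> base <= 1 ->
  0 < dstar R H -> (0 < #|V|)%N ->
  #|perms_containing h H U|%:R <= n`!%:R * (base `^ (dstar R H)^-1) ^+ #|U| :> R.
Proof.
move=> n0 b1 d0 V0.
have nR : 0 < n%:R :> R by rewrite ltr0n.
have b0 : 0 < base.
  by rewrite divr_gt0 // mulr_gt0 ?exprn_gt0 ?expR_gt0 // ltr0n.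
(* [card_le_dstar] needs one permutation containing [U]; if there is none, the left side is 0. *)
have [->|[s sv]] := set_0Vmem (perms_containing h H U).
  by rewrite cards0 mulr_ge0 // exprn_ge0 // powR_ge0.
apply: le_trans (card_perms_containing_le U n0) _.
move: base b0 b1 => b b0 b1.
rewrite ler_wpM2l // -!powR_mulrn ?powR_ge0 ?(ltW b0) // -powRrM.
rewrite ger_powR ?b0 // ler_pdivrMl //.
exact: (card_le_dstar hK gK R k2 Hk sv).
Qed.

Definition factors : {set {set {set T}}} :=
  [set factor_edges h H s | s : {perm T}].

(** Double counting: each of the [n!] permutations contains some [U] in [C], so the sets
    [perms_containing] have total size at least [n!]. *)
Lemma factors_cover_cost : (0 < n)%N -> base <= 1 ->
  0 < dstar R H -> (0 < #|V|)%N ->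
  cover_cost_ge (base `^ (dstar R H)^-1) factors 1.
Proof.
move=> n0 b1 d0 V0 C covC.
have f0 : 0 < n`!%:R :> R by rewrite ltr0n fact_gt0.
rewrite -(ler_pM2l f0) mulr1 mulr_sumr.
apply: le_trans (_ : \sum_(U in C) #|perms_containing h H U|%:R <= _); last first.
  by apply: ler_sum => U _; exact: perms_containing_spread.
rewrite -natr_sum ler_nat.
have -> : n`! = #|{perm T}|.
  have := card_perm [set: T]; rewrite cardsT => <-.
  by apply: eq_card => s; apply/subsetP => x _; rewrite inE.
rewrite -sum1_card.
under [leqRHS]eq_bigr do rewrite -sum1_card big_mkcond /=.
rewrite exchange_big /=; apply: leq_sum => s _.
have [|U UC Us] := covC (factor_edges h H s); first by rewrite imset_f.
by rewrite (bigD1 U) //= inE Us.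
Qed.

End Spread.

(** A nonuniform [W] has weight 0 under [prob_on]; for a uniform one, the factors at sets of size
    other than [k] are all 1. *)
Lemma prob_HkE (R : realType) (k n : nat) (p : R) (P : pred {set {set 'I_n}}) :
  prob_Hk k p P = \sum_W bern (prob_on [set e : {set 'I_n} | #|e| == k] p) W * (P W)%:R.
Proof.
rewrite /prob_Hk big_mkcond; apply: eq_bigr => W _.
have [/forall_inP Wk|] := boolP (uniform k W).
  rewrite /bern [in RHS](bigID (fun e : {set 'I_n} => #|e| == k)) /=.
  rewrite [X in _ * X * _]big1 => [|e ek]; last first.
    by rewrite /prob_on inE (negPf ek) subr0; case: ifP => // /Wk; rewrite (negPf ek).
  rewrite mulr1; case: (P W); rewrite ?mulr0 // mulr1.
  by apply: eq_bigr => e ek; rewrite /prob_on inE ek.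
rewrite negb_forall => /existsP[e]; rewrite negb_imply => /andP[eW ek].
by rewrite /bern [in RHS](bigD1 e) //= eW /prob_on inE (negPf ek) !mul0r.
Qed.

(** A hypergraph that hits [factors] has an [H]-factor, so [miss] bounds the failure probability;
    [M] rounds suffice because each factor has fewer than [2 ^ M] edges. *)
Lemma prob_factor_ge (R : realType) (k n m M : nat) (V : finType)
    (H : {set {set V}}) (p : R) :
  (2 <= k)%N -> uniform k H -> 0 < dstar R H -> (0 < #|V|)%N ->
  (0 < n)%N -> n = (m * #|V|)%N -> 0 < p <= 1 ->
  (0 < M)%N -> (n * #|H| < 2 ^ M)%N ->
  expR 1 ^+ 2 * #|V|%:R <= n%:R :> R ->
  let q := (expR 1 ^+ 2 * #|V|%:R / n%:R) `^ (dstar R H)^-1 in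
  4 * M%:R * q <= p ->
  1 - 4 * M%:R ^+ 2 * q / p <= prob_Hk k p (@has_factor V 'I_n H) <= 1.
Proof.
move=> k2 Hk d0 V0 n0 nE p01 M0 cM b1 q qp.
have [h [g [hK gK]]] : exists (h : 'I_m * V -> 'I_n) (g : 'I_n -> 'I_m * V),
    cancel h g /\ cancel g h.
  by apply: card_eq_bij; rewrite card_prod !card_ord.
have nR : 0 < n%:R :> R by rewrite ltr0n.
have := @miss_spread R {set 'I_n} [set e : {set 'I_n} | #|e| == k] p q M (factors h H)
  (powR_ge0 _ _) p01 M0 qp.
have [p0 p1] := andP p01.
have pD (e : {set 'I_n}) : 0 <= prob_on [set e : {set 'I_n} | #|e| == k] p e <= 1.
  by rewrite /prob_on; case: ifP => _; rewrite ?lexx ?ler01 ?p1 ?ltW.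
rewrite prob_HkE => missle; apply/andP; split; last first.
  rewrite -[leRHS](sum_bern (prob_on [set e : {set 'I_n} | #|e| == k] p)).
  by apply: ler_sum => W _; rewrite ler_piMr ?bern_ge0 // lern1 leq_b1.
rewrite lerBlDl -lerBlDr
  -[X in X - _](sum_bern (prob_on [set e : {set 'I_n} | #|e| == k] p)).
rewrite -sumrB; apply: le_trans (missle _ _ _).
- apply: ler_sum => W _; rewrite -{1}[bern _ W]mulr1 -mulrBr ler_wpM2l ?bern_ge0 //.
  have [/exists_inP[_ /imsetP[s _ ->] sW]|_] := boolP (hits _ W).
    by rewrite (has_factor_edges hK gK V0 sW) subrr.
  by rewrite lerBlDr lerDl.
- move=> _ /imsetP[s _ ->]; apply/subsetP => A.
  move=> /factor_edgesP[i [e [eH ->]]]; rewrite inE card_imset.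
    by have /forall_inP/(_ e eH) := Hk.
  exact: copyfun_inj hK _ _.
- move=> _ /imsetP[s _ ->]; apply: leq_ltn_trans cM.
  apply: leq_trans (card_factor_edges h H s) _.
  by rewrite card_ord leq_mul2r nE leq_pmulr // orbT.
- have := @factors_cover_cost R k _ _ _ h g hK gK H k2 Hk.
  by rewrite card_ord; apply => //; rewrite ler_pdivrMr // mul1r.
Qed.

Lemma dstar_gt0 (R : realType) (k : nat) (V : finType) (H : {set {set V}}) :
  (2 <= k)%N -> uniform k H -> (0 < #|H|)%N -> 0 < dstar R H /\ (2 <= #|V|)%N.
Proof.
move=> k2 Hk /[dup] H0 /card_gt0P[e eH].
have V2 : (2 <= #|V|)%N.
  apply: leq_trans k2 _; have /forall_inP/(_ e eH)/eqP <- := Hk.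
  exact: max_card.
split=> //; pose S := ([set: V], H).
have SP : subhyp_of H S && (2 <= #|S.1|)%N.
  rewrite cardsT V2 andbT /subhyp_of subxx /=.
  by apply/forall_inP => A _; rewrite subsetT.
apply: lt_le_trans (le_bigmax_cond 0 (@density R V) SP).
by rewrite /density /= divr_gt0 ?ltr0n // cardsT subr_gt0 ltr1n.
Qed.

(** With [y = sqrt (ln n)], the right-hand power is [expR y], while the logarithm is at most
    [a + b * y ^+ 2]; its square has degree 4 in [y]. *)
Lemma log_le_powR (R : realType) (h : nat) : (0 < h)%N ->
  exists2 A : R, 0 < A & forall n : nat, (1 < n)%N ->
    (trunc_log 2 (n * h)).+1%:R ^+ 2 <= A * n%:R `^ (Num.sqrt (ln n%:R))^-1.
Proof.
move=> h0.
have ln2 : 0 < ln 2 :> R by rewrite ln_gt0 // ltr1n.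
have lnh : 0 <= ln h%:R :> R by rewrite ln_ge0 // ler1n.
pose b : R := (ln 2)^-1; pose a : R := 1 + ln h%:R * b.
have b0 : 0 < b by rewrite invr_gt0.
have a0 : 0 < a by rewrite ltr_wpDr // mulr_ge0 // ltW.
(* Expand [(a + b * y ^+ 2) ^+ 2] and insert the Taylor bounds [1 <= expR y], [y ^+ 2 <= 2 * expR y]
   and [y ^+ 4 <= 24 * expR y]. *)
exists (a ^+ 2 + 4 * a * b + 24 * b ^+ 2) => [|n n1].
  by rewrite !addr_gt0 ?mulr_gt0 ?exprn_gt0.
have n0 : 0 < n%:R :> R by rewrite ltr0n ltnW.
have lnn : 0 < ln n%:R :> R by rewrite ln_gt0 // ltr1n.
pose y : R := Num.sqrt (ln n%:R); rewrite -/y.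
have y0 : 0 < y by rewrite sqrtr_gt0.
have yE : y ^+ 2 = ln n%:R by rewrite sqr_sqrtr // ltW.
have -> : n%:R `^ y^-1 = expR y.
  by rewrite /powR gt_eqF // -yE expr2 mulrA mulVf ?mul1r // gt_eqF.
have Mle : (trunc_log 2 (n * h)).+1%:R <= a + b * y ^+ 2.
  have : (2 ^ trunc_log 2 (n * h) <= n * h)%N.
    by rewrite trunc_logP // muln_gt0 h0 ltnW.
  rewrite -(ler_nat R) natrX natrM
    -ler_ln ?posrE ?exprn_gt0 ?mulr_gt0 ?ltr0n ?(ltnW n1) //.
  rewrite lnXn // lnM ?posrE ?ltr0n // ?(ltnW n1) // -[ln _ *+ _]mulr_natr => le.
  rewrite yE -addn1 natrD addrC /a -addrA lerD2l -(ler_pM2l ln2).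
  apply: le_trans le _; rewrite le_eqVlt; apply/orP; left; apply/eqP.
  by rewrite /b; field; rewrite gt_eqF.
have E2 : y ^+ 2 <= 2 * expR y.
  have := @expR_ge1Dxn R y 1 (ltW y0); rewrite (_ : 2`!%:R = 2) //.
  lra.
have E4 : y ^+ 4 <= 24 * expR y.
  have := @expR_ge1Dxn R y 3 (ltW y0); rewrite (_ : 4`!%:R = 24) //.
  lra.
have E0 : 1 <= expR y by apply: le_trans (expR_ge1Dx _); rewrite lerDl ltW.
apply: (@le_trans _ _ ((a + b * y ^+ 2) ^+ 2)).
  by rewrite lerXn2r ?nnegrE // addr_ge0 ?mulr_ge0 ?exprn_ge0 // ltW.
have -> : (a + b * y ^+ 2) ^+ 2 = a ^+ 2 * 1 + 2 * a * b * y ^+ 2 + b ^+ 2 * y ^+ 4.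
  by ring.
have -> : (a ^+ 2 + 4 * a * b + 24 * b ^+ 2) * expR y =
  a ^+ 2 * expR y + 2 * a * b * (2 * expR y) + b ^+ 2 * (24 * expR y) by ring.
have ab0 : 0 <= 2 * a * b by rewrite !mulr_ge0 // ltW.
by rewrite !lerD // ler_wpM2l // exprn_ge0 // ltW.
Qed.

Unset Implicit Arguments.
Local Open Scope classical_set_scope.
Local Open Scope ring_scope.

Theorem theorem2p7 (R : realType) (k : nat) (hk : (2 <= k)%N)
    (V : finType) (H : {set {set V}}) (Hunif : uniform k H)
    (Hedge : (0 < #|H|)%N) :
  exists eps : nat -> R,
    eps n @[n --> multiples #|V|] --> (0 : R) /\
    forall p : nat -> R,
      (forall n, 0 <= p n <= 1) ->
      p n / (n%:R `^ (- 1 / dstar R H + eps n)) @[n --> multiples #|V|]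
        --> +oo ->
      prob_Hk k (p n) (@has_factor V 'I_n H) @[n --> multiples #|V|]
        --> (1 : R).
Proof.
have [d0 V2] := dstar_gt0 R hk Hunif Hedge.
have V0 : (0 < #|V|)%N by exact: ltnW.
pose eps n : R := (Num.sqrt (ln n%:R))^-1.
exists eps; split.
  apply: cvg_within_filter.
  apply/cvgr0Pnorm_lt => e e0.
  near=> n.
  have n1 : expR (e^-1 ^+ 2) < n%:R by near: n; exact: nbhs_infty_gtr.
  have lnn : e^-1 ^+ 2 < ln n%:R.
    rewrite -(expRK (e^-1 ^+ 2)) ltr_ln ?posrE ?expR_gt0 //.
    exact: lt_trans (expR_gt0 _) n1.
  have eV : 0 < e^-1 by rewrite invr_gt0.
  have sq : e^-1 < Num.sqrt (ln n%:R).
    rewrite -[ltLHS]gtr0_norm // -sqrtr_sqr ltr_sqrt //.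
    exact: lt_trans (exprn_gt0 2 eV) lnn.
  have sq0 := lt_trans eV sq.
  by rewrite gtr0_norm ?invr_gt0 // -[ltRHS]invrK ltf_pV2 ?posrE.
move=> p p01 pinf.
have [A A0 logle] := log_le_powR R Hedge.
pose r n := p n / (n%:R `^ (- 1 / dstar R H + eps n)).
pose K : R := expR 1 ^+ 2 * #|V|%:R.
(* The product of the constant in [miss_spread], the constant of [log_le_powR] and the part of [q]
   independent of [n]. *)
pose B := 4 * A * K `^ (dstar R H)^-1.
have K0 : 0 < K by rewrite mulr_gt0 ?exprn_gt0 ?expR_gt0 // ltr0n.
have B0 : 0 < B by rewrite !mulr_gt0 ?powR_gt0.
(* The failure probability is at most [B / r n], which vanishes because [r n] tends to infinity. *)
apply: (@squeeze_cvgr _ _ _ _ (fun n => 1 - B * (r n)^-1) (fun=> 1)); last 2 first.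
- suff : 1 - B * (r n)^-1 @[n --> multiples #|V|] --> 1 - B * 0.
    by rewrite mulr0 subr0.
  apply: cvgB; first exact: cvg_cst.
  apply: cvgMr; apply/gtr0_cvgV0 => //.
  exact: (cvgryPgt _).1 pinf 0.
- exact: cvg_cst.
near=> n.
have rB : B <= r n by near: n; exact: (cvgryPge _).1 pinf B.
have r0 : 0 < r n by exact: lt_le_trans B0 rB.
have vn : (#|V| %| n)%N by near: n; exact: withinT.
have [Kn n2] : K <= n%:R /\ (1 < n)%N.
  split; near: n; apply: cvg_within.
    exact: nbhs_infty_ger.
  exact: nbhs_infty_gt.
have n0 : 0 < n%:R :> R by rewrite ltr0n ltnW.
have [p0 p1] := andP (p01 n).
have pow0 x : 0 < n%:R `^ x :> R by rewrite powR_gt0.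
have pn0 : 0 < p n.
  by rewrite -(pmulr_lgt0 _ (_ : 0 < (n%:R `^ (- 1 / dstar R H + eps n))^-1)) ?invr_gt0.
have nE : n = ((n %/ #|V|) * #|V|)%N by rewrite divnK.
pose M := (trunc_log 2 (n * #|H|)).+1.
pose q := (K / n%:R) `^ (dstar R H)^-1.
have qE : q = K `^ (dstar R H)^-1 * n%:R `^ (- 1 / dstar R H).
  rewrite /q powRM ?invr_ge0 ?(ltW K0) ?(ltW n0) //; congr (_ * _).
  by rewrite -powR_inv1 ?(ltW n0) // -powRrM.
(* [p n / r n] is the power of [n] in the threshold, and its factor [n ^ eps n] absorbs [M ^ 2]. *)
have MB : 4 * M%:R ^+ 2 * q <= B * (p n / r n).
  rewrite /r invfM invrK [p n * _]mulrA divff ?gt_eqF // mul1r powRD; last first.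
    by rewrite [n%:R == _]gt_eqF ?implybT.
  have := logle n n2; rewrite -/M -/(eps n) => Mle.
  rewrite qE /B.
  have -> : 4 * A * K `^ (dstar R H)^-1 * (n%:R `^ (-1 / dstar R H) * n%:R `^ eps n) =
    4 * (A * n%:R `^ eps n) * (K `^ (dstar R H)^-1 * n%:R `^ (-1 / dstar R H)).
    by ring.
  by rewrite ler_wpM2r ?mulr_ge0 ?powR_ge0 // ler_wpM2l.
have q0 : 0 <= q by exact: powR_ge0.
have := @prob_factor_ge R k n (n %/ #|V|) M V H (p n) hk Hunif d0 V0 (ltnW n2) nE.
rewrite pn0 p1 => /(_ isT isT).
rewrite /M trunc_log_ltn // => /(_ isT Kn) /=; rewrite -/M -/q.
case/(_ _)/andP => [|lo ->].
  (* The density condition follows from [MB], since [M >= 1] and [B <= r n]. *)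
  apply: (@le_trans _ _ (4 * M%:R ^+ 2 * q)).
    rewrite ler_wpM2r // ler_wpM2l // expr2 ler_peMl ?ler0n //.
    by rewrite ler1n.
  apply: le_trans MB _; rewrite mulrCA ler_piMr // ler_pdivrMr // mul1r //.
rewrite andbT; apply: le_trans lo; rewrite lerD2l lerN2.
by rewrite ler_pdivrMr // -[leRHS]mulrA [(r n)^-1 * _]mulrC.
Unshelve. all: by end_near.
Qed.
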